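(* Let $k=2m-1\ge1$ be an odd integer. There is a symmetric banded matrix $\mathbb{V}^m_n\in\mathbb{R}^{(n-m)\times(n-m)}$ (with $[a,b]$ and $m$ fixed, depending only on $x_1,\ldots,x_n$), of bandwidth $2m-1$ (that is, $(\mathbb{V}^m_n)_{ij}=0$ whenever $|i-j|\ge m$), such that for every $k$th degree discrete spline $f\in\mathcal{H}^k_n$ (with knots in $\{x_{k+1},\ldots,x_{n-1}\}$), $$\int_a^b(D^mf)(x)^2\,dx=\big\|(\mathbb{V}^m_n)^{\frac12}\,\mathbb{D}^m_nf(x_{1:n})\big\|_2^2,$$ where $f(x_{1:n})=(f(x_1),\ldots,f(x_n))\in\mathbb{R}^n$ and $\mathbb{D}^m_n\in\mathbb{R}^{(n-m)\times n}$ is the $m$th order discrete derivative matrix.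
   Context: Design points: $a\le x_1<\cdots<x_n\le b$ with $n\ge k+1$. Empty products equal 1. Falling factorial basis on $[a,b]$: $h^k_j(x)=\frac1{(j-1)!}\prod_{\ell=1}^{j-1}(x-x_\ell)$ for $j=1,\ldots,k+1$, and $h^k_j(x)=\frac1{k!}\prod_{\ell=j-k}^{j-1}(x-x_\ell)\cdot1\{x>x_{j-1}\}$ for $j=k+2,\ldots,n$. $\mathcal{H}^k_n=\mathrm{span}\{h^k_1,\ldots,h^k_n\}$ is the space of $k$th degree discrete splines with knots in $\{x_{k+1},\ldots,x_{n-1}\}$. $D^m$ is the $m$-fold derivative, each derivative being read as the left derivative where the derivative does not exist (the functions in $\mathcal{H}^k_n$ are piecewise polynomials; in particular $D^mf$ is defined pointwise, not as a distribution). Discrete derivative matrix: $(\mathbb{D}^m_nf(x_{1:n}))_i=m!\,f[x_i,\ldots,x_{i+m}]$, $i=1,\ldots,n-m$, where divided differences are $f[z]=f(z)$ and $f[z_1,\ldots,z_{r+1}]=(f[z_2,\ldots,z_{r+1}]-f[z_1,\ldots,z_r])/(z_{r+1}-z_1)$. $\mathbb{V}^{1/2}$ denotes the symmetric square root of a positive semidefinite matrix. The bandwidth of a banded matrix counts the total number of (possibly) nonzero diagonals, so bandwidth 1 is diagonal and bandwidth 3 is tridiagonal. *)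

(* Defs.v *)
(* MathComp-Analysis *)
From HB Require Import structures.
From mathcomp Require Import all_boot all_order all_algebra.
From mathcomp Require Import all_classical all_reals all_analysis.

Set Implicit Arguments.
Unset Strict Implicit.
Unset Printing Implicit Defensive.

Import Order.TTheory GRing.Theory Num.Theory.
Import numFieldNormedType.Exports.

Local Open Scope classical_set_scope.
Local Open Scope ring_scope.

(* Indices start at 0: x`_i and [falling_factorial k x i] are the classical
   x_{i+1} and h^k_{i+1}.  The second branch is the truncated part of the basis;
   its knot is the last of the k points entering the product. *)
Definition falling_factorial (R : realType) (k : nat) (x : seq R) (j : nat)
    (t : R) : R :=
  if (j <= k)%N then (j`!%:R)^-1 * \prod_(0 <= l < j) (t - x`_l)
  else (k`!%:R)^-1 * (\prod_(j - k <= l < j) (t - x`_l)) * (x`_j.-1 < t)%R%:R.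

Definition discrete_spline (R : realType) (k n : nat) (x : n.-tuple R) :
    set (R -> R) :=
  [set f | exists c : 'I_n -> R,
     f = (fun t => \sum_(j < n) c j * falling_factorial k x j t)].

Definition lderive1 (R : realType) (f : R -> R) (t : R) : R :=
  if `[< derivable f t 1 >] then derive1 f t
  else lim (h^-1 * (f (t + h) - f t) @[h --> 0^'-]).

Definition lderive1n (R : realType) (m : nat) (f : R -> R) : R -> R :=
  iter m (@lderive1 R) f.

(* f[z 0, ..., z r] *)
Fixpoint divdiff (R : realType) (f : R -> R) (z : nat -> R) (r : nat) : R :=
  if r is r'.+1 then
    (divdiff f (fun l => z l.+1) r' - divdiff f z r') / (z r - z 0%N)
  else f (z 0%N).

Definition sample (R : realType) (n : nat) (f : R -> R) (x : n.-tuple R) :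
    'cV[R]_n := \col_i f x`_i.

(* The j-th column is the vector of scaled divided differences of the function
   that is 1 at x`_j and 0 elsewhere; see [discrete_derive_mxE]. *)
Definition discrete_derive_mx (R : realType) (m n : nat) (x : n.-tuple R) :
    'M[R]_(n - m, n) :=
  \matrix_(i, j)
    (m`!%:R * divdiff (fun t => (t == x`_j)%:R) (fun l => x`_(i + l)) m).

Definition psd_mx (R : realType) (p : nat) (A : 'M[R]_p) : Prop :=
  forall u : 'cV[R]_p, 0 <= (u^T *m A *m u) 0 0.

(* When A is symmetric positive semidefinite, there is exactly one such S.  The
   default value 0 is taken only if A has no such square root. *)
Definition sqrt_mx (R : realType) (p : nat) (A : 'M[R]_p) : 'M[R]_p :=
  xget 0 [set S | [/\ S^T = S, psd_mx S & S *m S = A]].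

Definition l2norm (R : realType) (p : nat) (u : 'cV[R]_p) : R :=
  Num.sqrt (\sum_i u i 0 ^+ 2).

Lemma divdiff_sum (R : realType) (n : nat) (c : 'I_n -> R) (g : 'I_n -> R -> R)
    (f : R -> R) (z : nat -> R) (r : nat) :
  (forall l, (l <= r)%N -> f (z l) = \sum_(j < n) g j (z l) * c j) ->
  divdiff f z r = \sum_(j < n) divdiff (g j) z r * c j.
Proof.
elim: r z => [|r IH] z H /=; first exact: H.
rewrite (IH z) => [|l lr]; last by apply: H; rewrite ltnW.
rewrite (IH (fun l => z l.+1)) => [|l lr]; last exact: H.
rewrite -sumrB mulr_suml; apply: eq_bigr => j _.
by rewrite -mulrBl mulrAC.
Qed.

Lemma discrete_derive_mxE (R : realType) (m n : nat) (x : n.-tuple R)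
    (f : R -> R) : sorted <%R x ->
  discrete_derive_mx m x *m sample f x =
  \col_i (m`!%:R * divdiff f (fun l => x`_(i + l)) m).
Proof.
move=> xs; apply/colP => i; rewrite !mxE.
rewrite (divdiff_sum (n := n) (c := fun j => f x`_j)
  (g := fun j t => (t == x`_j)%:R)).
  by rewrite mulr_sumr; apply: eq_bigr => j _; rewrite !mxE mulrA.
move=> l lm.
have iln : (i + l < n)%N.
  by apply: leq_ltn_trans (_ : i + m < n)%N; rewrite ?leq_add2l // addnC -ltn_subRL.
have ux : uniq x by apply: sorted_uniq xs; [exact: lt_trans|exact: ltxx].
rewrite (bigD1 (Ordinal iln)) //= eqxx mul1r big1 ?addr0 // => j jil.
rewrite nth_uniq ?size_tuple //.
case: eqP => [e|_]; last by rewrite mul0r.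
by move/eqP: jil; case; apply: val_inj.
Qed.

(* Main.v *)
Require Import Defs.
From HB Require Import structures.
From mathcomp Require Import all_boot all_order all_algebra.
From mathcomp Require Import all_classical all_reals all_analysis.
From mathcomp Require Import zify measurable_realfun complex.

(** A discrete spline [f] of degree [k = 2m - 1] is a polynomial on each piece
    between consecutive knots, and the reason for the theorem is that on the
    piece ending at [x_j] this polynomial interpolates [f] at the [k + 1] design
    points [x_(j-k), ..., x_j].  Indeed a truncated basis function that is
    active on the piece agrees with its polynomial part at all these points,
    because the product defining it vanishes at the [k] design points up to its
    knot, and one that is not active is zero at all of them
    ([discrete_spline_interp]).

    Newton's formula writes the interpolating polynomial with divided
    differences of [f] over these [2m] consecutive points; the [m]-th derivative
    kills the terms of order less than [m], and the divided differences of order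
    at least [m] are combinations of those of order exactly [m]
    ([derivn_divdiff]).  So on each piece [D^m f] is a combination, with
    polynomial coefficients independent of [f], of only [m] consecutive entries
    of [D_n^m f(x)].  Integrating the square piece by piece gives a quadratic
    form in [D_n^m f(x)] whose matrix is a sum of Gram matrices of polynomials
    ([gram_mx]): it is symmetric and positive semidefinite, and two indices at
    distance at least [m] never meet on the same piece, which is the band.

    Two analytic points remain.  The one-sided derivatives are harmless: on an
    interval open on the left and closed on the right where a function is
    a polynomial, its left derivative is the derivative of that polynomial, also
    at the right end ([lderive1_horner]).  And a symmetric positive semidefinite
    real matrix has a square root, obtained as a polynomial in the matrix
    ([psd_sqrt_exists]), so that the norm in the statement is the quadratic
    form ([l2norm_sqrt_mx]). *)

Set Implicit Arguments.
Unset Strict Implicit.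
Unset Printing Implicit Defensive.

Import Order.TTheory GRing.Theory Num.Theory.
Import numFieldNormedType.Exports.

Local Open Scope classical_set_scope.
Local Open Scope ring_scope.

(** * Divided differences and Newton's formula *)

Lemma eq_divdiff (R : realType) (f g : R -> R) (z : nat -> R) (r : nat) :
  (forall l, (l <= r)%N -> f (z l) = g (z l)) -> divdiff f z r = divdiff g z r.
Proof.
elim: r z => [|r IH] z fg /=; first exact: fg.
by rewrite (IH z) ?(IH (fun l => z l.+1)) // => l lr; apply: fg => //;
  exact: leqW.
Qed.

Definition newton_poly (R : realType) (z : nat -> R) (r : nat) : {poly R} :=
  \prod_(c <- mkseq z r) ('X - c%:P).

Lemma size_newton_poly (R : realType) (z : nat -> R) (r : nat) :
  size (newton_poly z r) = r.+1.
Proof. by rewrite size_prod_XsubC size_mkseq. Qed.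

Lemma newton_poly_root (R : realType) (z : nat -> R) (r l : nat) :
  (l < r)%N -> (newton_poly z r).[z l] = 0.
Proof.
by move=> lr; apply/rootP; rewrite root_prod_XsubC; apply: map_f;
  rewrite mem_iota.
Qed.

Lemma coef_newton_poly (R : realType) (z : nat -> R) (r : nat) :
  (newton_poly z r)`_r = 1.
Proof.
have /monicP := monic_prod_XsubC (mkseq z r) xpredT id.
by rewrite /lead_coef size_newton_poly.
Qed.

Lemma size_sub_newton_poly (R : realType) (z : nat -> R) (r : nat) (p
    : {poly R}) :
  (size p <= r.+1)%N -> (size (p - p`_r *: newton_poly z r)%R <= r)%N.
Proof.
move=> sp; apply/leq_sizeP => j;
  rewrite leq_eqVlt coefB coefZ => /orP[/eqP<-|rj].
  by rewrite coef_newton_poly mulr1 subrr.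
rewrite (nth_default _ (leq_trans sp rj)) [X in _ * X]nth_default ?mulr0 ?subrr //.
by rewrite size_newton_poly.
Qed.

(** By induction on the order.  Subtracting a multiple of the node polynomial of
    [r + 1] points changes no value at these points and lowers the degree, so
    the two divided differences of order [r] in the recursion are coefficients
    of degree [r]; they differ by [p`_r.+1] times the difference of the sums of
    the nodes, that is, by [p`_r.+1 * (z r.+1 - z 0)]. *)
Lemma divdiff_poly (R : realType) (p : {poly R}) (z : nat -> R) (r : nat) :
  (forall i j, (i < j <= r)%N -> z i != z j) ->
  (size p <= r.+1)%N -> divdiff (horner p) z r = p`_r.
Proof.
elim: r p z => [|r IH] p z zD sp /=.
  by rewrite (size1_polyC sp) hornerC coefC.
have lower y : (forall i j, (i < j <= r)%N -> y i != y j) ->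
    divdiff (horner p) y r = p`_r + p`_r.+1 * \sum_(c <- mkseq y r.+1) c.
  move=> yD; pose q := p - p`_r.+1 *: newton_poly y r.+1.
  rewrite (@eq_divdiff _ _ (horner q)) => [|l lr]; last first.
    by rewrite hornerD hornerN hornerZ newton_poly_root // mulr0 subr0.
  rewrite IH ?size_sub_newton_poly // coefB coefZ.
  have := @coefPn_prod_XsubC R (mkseq y r.+1).
  by rewrite size_mkseq /= => -> //; rewrite mulrN opprK.
rewrite !lower => [|i j /andP[ij jr]|i j /andP[ij jr]]; last 2 first.
- by apply: zD; rewrite ij leqW.
- by apply: zD; rewrite ltnS ij.
have z0r : z r.+1 - z 0%N != 0 by rewrite subr_eq0 eq_sym zD /=.
have sums : z 0%N + \sum_(c <- mkseq (fun l => z l.+1) r.+1) c =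
            \sum_(c <- mkseq z r.+1) c + z r.+1.
  transitivity (\sum_(c <- mkseq z r.+2) c); last by rewrite mkseqS big_rcons.
  rewrite /mkseq -[iota 0 r.+2]/(0%N :: iota (1 + 0) r.+1) iotaDl.
  by rewrite map_cons [RHS]big_cons !big_map.
apply: (mulIf z0r); rewrite divfK // opprD addrACA subrr add0r -mulrBr;
  congr (_ * _).
by apply/eqP;
  rewrite subr_eq addrAC -[X in X - _]addrC -sums addrAC addrN add0r.
Qed.

(** Newton's interpolation formula: the leading coefficient is the divided
    difference of highest order, and removing the corresponding term leaves the
    values at the earlier nodes unchanged. *)
Lemma newton_expansion (R : realType) (p : {poly R}) (z : nat -> R) (r : nat) :
  (forall i j, (i < j < r)%N -> z i != z j) -> (size p <= r)%N ->
  p = \sum_(s < r) divdiff (horner p) z s *: newton_poly z s.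
Proof.
elim: r p => [|r IH] p zD sp.
  by rewrite big_ord0; apply/eqP; rewrite -size_poly_leq0.
rewrite big_ord_recr /= divdiff_poly // -[LHS](subrK (p`_r *: newton_poly z r)).
congr (_ + _); rewrite [LHS]IH ?size_sub_newton_poly // => [|i j /andP[ij jr]].
  apply: eq_bigr => s _; congr (_ *: _); apply: eq_divdiff => l ls.
  by rewrite hornerD hornerN hornerZ newton_poly_root ?mulr0 ?subr0 // (leq_ltn_trans ls).
by apply: zD; rewrite ij leqW.
Qed.

(** The recursion defining divided differences expresses those of order [m + s]
    linearly, with weights depending on the nodes alone, through the [s + 1]
    consecutive ones of order [m]. *)
Lemma divdiff_raise (R : realType) (m s : nat) (z : nat -> R) :
  exists w : nat -> R, forall f : R -> R,
    divdiff f z (m + s) = \sum_(i < s.+1) w i * divdiff f (fun l => z (i + l)%N) m.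
Proof.
elim: s z => [|s IH] z.
  by exists (fun=> 1) => f; rewrite big_ord1 mul1r addn0.
have [w1 w1E] := IH (fun l => z l.+1); have [w0 w0E] := IH z.
pose d := z (m + s).+1 - z 0%N.
exists (fun i => ((if i is i'.+1 then w1 i' else 0) - (if (i <= s)%N then w0 i else 0)) / d).
move=> f; rewrite addnS /= -/d w1E w0E.
under [RHS]eq_bigr do rewrite mulrAC mulrBl.
rewrite -mulr_suml; congr (_ / _); rewrite sumrB; congr (_ - _).
  by rewrite [RHS]big_ord_recl /= mul0r add0r.
rewrite [RHS]big_ord_recr /= ltnn mul0r addr0.
by apply: eq_bigr => i _; rewrite -ltnS ltn_ord.
Qed.

(** Newton's formula after [m] derivations: the terms of order less than [m]
    vanish and the others reduce to order [m].  The scaling by [m`!] matches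
    that of the discrete derivative matrix. *)
Lemma derivn_divdiff (R : realType) (m q : nat) (z : nat -> R) :
  (forall i j, (i < j < m + q)%N -> z i != z j) ->
  exists G : nat -> {poly R}, forall p : {poly R}, (size p <= m + q)%N ->
    p^`(m) = \sum_(i < q) (m`!%:R * divdiff (horner p) (fun l => z (i + l)%N) m) *: G i.
Proof.
move=> zD; have [w wE] := choice (fun s => @divdiff_raise R m s z).
exists (fun i => m`!%:R^-1 *: \sum_(s < q | (i <= s)%N)
                   w s i *: (newton_poly z (m + s))^`(m)) => p sp.
rewrite [in LHS](@newton_expansion R p z _ zD sp) linear_sum big_split_ord /=.
rewrite big1 ?add0r => [|s _]; last first.
  by rewrite derivnZ derivn_poly0 ?scaler0 // size_newton_poly.
under eq_bigr => s _.
  rewrite derivnZ wE scaler_suml (big_ord_widen q (fun i =>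
    (w s i * divdiff (horner p) (fun l => z (i + l)%N) m) *:
    (newton_poly z (m + s))^`(m)) (ltn_ord s)).
  over.
rewrite (exchange_big_dep xpredT) //=; apply: eq_bigr => i _.
rewrite scalerA mulrAC mulfV ?mul1r ?pnatr_eq0 -?lt0n ?fact_gt0 // scaler_sumr.
by apply: eq_big => // s _; rewrite scalerA mulrC.
Qed.

(** * Square roots of positive semidefinite matrices *)

Lemma interpolation_seq (F : fieldType) (g : F -> F) (s : seq F) :
  exists q : {poly F}, {in s, forall c, q.[c] = g c}.
Proof.
elim: s => [|c s [q qE]]; first by exists 0.
have [cs|cs] := boolP (c \in s).
  by exists q => e; rewrite in_cons => /predU1P[->|/qE//]; exact: qE.
pose w : {poly F} := \prod_(e <- s) ('X - e%:P).
have wc : w.[c] != 0 by rewrite -[_ == 0]/(root w c) root_prod_XsubC.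
exists (q + ((g c - q.[c]) / w.[c]) *: w) => e;
  rewrite in_cons => /predU1P[->|es].
  by rewrite hornerD hornerZ divfK // addrC subrK.
have /rootP we : root w e by rewrite root_prod_XsubC.
by rewrite hornerD hornerZ we mulr0 addr0 qE.
Qed.

(** The spectral theorem, in the form needed for functional calculus over the
    real field [R] itself: a polynomial vanishing on the spectrum of [A] kills
    [A].  The matrix is unitarily diagonalized over the complex field [C], where
    its eigenvalues are real, hence in the image of [R]. *)
Lemma symmetric_mx_diagonalizable (R : fieldType) (C : numClosedFieldType)
    (f : {rmorphism R -> C}) (p : nat) (A : 'M[R]_p.+1) :
  (forall z, z \is Num.real <-> exists c, z = f c) -> A^T = A ->
  exists s : seq R, {in s, forall c, eigenvalue A c} /\
    forall q : {poly R}, {in s, forall c, q.[c] = 0} -> horner_mx A q = 0.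
Proof.
move=> fP symA; pose B := map_mx f A.
have Breal : B \is a mxOver Num.real.
  by apply/mxOverP => i j; rewrite mxE; apply/fP; exists (A i j).
have Bherm : B \is hermsymmx.
  by apply/is_hermitianmxP; rewrite expr0 scale1r map_trmx symA realmxC.
have /mxOverP dreal := hermitian_spectral_diag_real Bherm.
have /orthomx_spectralP := hermitian_normalmx Bherm.
set P := spectralmx B; set d := spectral_diag B => BE.
have Pu : P \in unitmx by exact: spectral_unit.
have [e de] := choice (fun i => (fP _).1 (dreal 0 i)).
rewrite -/d in de.
exists (map e (enum 'I_p.+1)); split.
  move=> _ /mapP[i _ ->]; rewrite eigenvalue_root_char -(fmorph_root f).
  rewrite map_char_poly -eigenvalue_root_char -/B -de; apply/eigenvalueP.
  exists (row i P).
    by rewrite -row_mul {1}BE !mulmxA (mulmxV Pu) mul1mx row_mul row_diag_mx -scalemxAl -rowE.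
  apply/eqP; rewrite rowE => /(congr1 (mulmx^~ (invmx P))).
  rewrite mulmxK // mul0mx => /rowP/(_ i); rewrite !mxE !eqxx.
  by move/eqP; rewrite oner_eq0.
move=> q q0; apply: (map_mx_inj (f := f)); rewrite map_horner_mx -/B map_mx0 BE.
rewrite horner_mx_uconjC // horner_mx_diag.
suff -> : map_mx (horner (map_poly f q)) d = 0 by rewrite raddf0 mulmx0 mul0mx.
apply/rowP => i; rewrite !mxE de horner_map q0 ?rmorph0 //.
by apply: map_f; rewrite mem_enum.
Qed.

Lemma psd_eigenvalue_ge0 (R : realType) (p : nat) (A : 'M[R]_p) (c : R) :
  psd_mx A -> eigenvalue A c -> 0 <= c.
Proof.
move=> psdA /eigenvalueP[v vA v0]; have := psdA v^T.
rewrite trmxK vA -scalemxAl mxE pmulr_lge0 // mxE.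
under eq_bigr do rewrite mxE -expr2.
rewrite lt_neqAle sumr_ge0 ?andbT => [|i _]; last exact: sqr_ge0.
apply: contra_neq v0 => /esym/psumr_eq0P s0.
by apply/rowP => i; apply/eqP; rewrite mxE -sqrf_eq0 s0 // => j _;
  exact: sqr_ge0.
Qed.

Lemma trmx_horner_mx (R : comNzRingType) (p : nat) (A : 'M[R]_p.+1) (q
    : {poly R}) :
  A^T = A -> (horner_mx A q)^T = horner_mx A q.
Proof.
move=> symA; elim/poly_ind: q => [|q c IH]; first by rewrite rmorph0 trmx0.
rewrite rmorphD rmorphM /= horner_mx_X horner_mx_C linearD /= tr_scalar_mx.
by rewrite trmx_mul symA IH; congr (_ + _); exact: comm_mx_horner.
Qed.

(** With [q] interpolating the fourth root on the spectrum of [A] and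
    [T = q(A)], the matrix [S = T^2] is a square root of [A], and it is positive
    semidefinite because it is the square of a symmetric matrix. *)
Lemma psd_sqrt_exists (R : realType) (p : nat) (A : 'M[R]_p) :
  A^T = A -> psd_mx A -> exists S, [/\ S^T = S, psd_mx S & S *m S = A].
Proof.
case: p A => [|p] A symA psdA.
  by exists A; split=> //; apply/matrixP => -[].
have [s [sA sK]] : exists s : seq R, {in s, forall c, eigenvalue A c} /\
    forall q : {poly R}, {in s, forall c, q.[c] = 0} -> horner_mx A q = 0.
  apply: (symmetric_mx_diagonalizable (f := real_complex R)) => // z.
  by split=> [/complex_realP//|zE]; exact/complex_realP.
have [q qE] := interpolation_seq (fun c => Num.sqrt (Num.sqrt c)) s.
pose T := horner_mx A q.
have symT : T^T = T by exact: trmx_horner_mx.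
exists (T *m T); split.
- by rewrite trmx_mul symT.
- move=> u; rewrite -[X in u^T *m (X *m _)]symT !mulmxA -trmx_mul -mulmxA mxE.
  by apply: sumr_ge0 => i _; rewrite mxE -expr2 sqr_ge0.
- rewrite (_ : T *m T = horner_mx A (q * q)); last by rewrite rmorphM.
  apply/eqP;
    rewrite -subr_eq0 -[X in _ - X]horner_mx_X -[_ *m _]rmorphM -rmorphB.
  apply/eqP/sK => c cs; rewrite hornerD hornerN hornerX !hornerM qE // -!expr2.
  by rewrite !sqr_sqrtr ?sqrtr_ge0 ?subrr // (psd_eigenvalue_ge0 psdA) ?sA.
Qed.

Lemma l2norm_sqrt_mx (R : realType) (p : nat) (A : 'M[R]_p) (u : 'cV[R]_p) :
  A^T = A -> psd_mx A -> l2norm (sqrt_mx A *m u) ^+ 2 = (u^T *m A *m u) 0 0.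
Proof.
move=> symA psdA; have [symS _ SS] : [/\ (sqrt_mx A)^T = sqrt_mx A,
    psd_mx (sqrt_mx A) & sqrt_mx A *m sqrt_mx A = A].
  exact: (xgetPex 0 (psd_sqrt_exists symA psdA)).
rewrite sqr_sqrtr; last by apply: sumr_ge0 => i _; exact: sqr_ge0.
rewrite -[in RHS]SS -[X in X *m _ *m _]trmxK.
rewrite -[X in _ *m (X *m _)]symS !mulmxA trmxK -trmx_mul -mulmxA mxE.
by apply: eq_bigr => i _; rewrite [X in X * _]mxE expr2.
Qed.

(** * Left derivatives and integrals of piecewise polynomials *)

Lemma cvg_left_quotient_horner (R : realType) (f : R -> R) (p : {poly R})
    (c t : R) :
  c < t -> (forall s, c < s <= t -> f s = p.[s]) ->
  h^-1 * (f (t + h) - f t) @[h --> 0^'-] --> p^`().[t].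
Proof.
move=> ct fp; have [dp <-] := is_derive_poly p t.
apply: cvg_trans (cvg_dnbhs_at_left dp); apply: near_eq_cvg; near=> h.
have h0 : h < 0 by near: h; exact: nbhs_left_lt.
have hct : c - t < h by near: h; apply: nbhs_left_gt; rewrite subr_lt0.
rewrite /= (fp t) ?ct ?lexx // (fp (t + h)); last first.
  by rewrite -ltrBlDl hct gerDl ltW.
by rewrite [_%:A]mulr1 [h + t]addrC.
Unshelve. all: by end_near.
Qed.

(** Whether or not the two-sided derivative exists at [t], the value is the
    limit of the left difference quotient, which only sees the polynomial.  The
    interval is closed on the right so that the statement iterates. *)
Lemma lderive1_horner (R : realType) (f : R -> R) (p : {poly R}) (c d : R) :
  (forall t, c < t <= d -> f t = p.[t]) ->
  forall t, c < t <= d -> lderive1 f t = p^`().[t].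
Proof.
move=> fp t /andP[ct td].
have fpt s : c < s <= t -> f s = p.[s].
  by move=> /andP[cs st]; rewrite fp // cs (le_trans st).
have ql := cvg_left_quotient_horner ct fpt.
rewrite /lderive1; case: asboolP => [df|_]; last exact: cvg_lim ql.
have qE : (fun h => h^-1 *: ((f \o shift t) (h *: 1) - f t)) =
          (fun h => h^-1 * (f (t + h) - f t)).
  by apply/funext => h; rewrite /= [_%:A]mulr1 [h + t]addrC.
move: df; rewrite derive1E /derivable /derive qE => /cvg_at_leftE ->.
exact: cvg_lim ql.
Qed.

Lemma lderive1n_horner (R : realType) (m : nat) (f : R -> R) (p : {poly R})
    (c d : R) :
  (forall t, c < t <= d -> f t = p.[t]) ->
  forall t, c < t <= d -> lderive1n m f t = p^`(m).[t].
Proof.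
move=> fp; elim: m => [//|m IH] t tcd.
by rewrite derivnS; exact: lderive1_horner IH t tcd.
Qed.

Lemma integrable_horner (R : realType) (p : {poly R}) (c d : R) :
  (@lebesgue_measure R).-integrable `]c, d] (EFin \o horner p).
Proof.
have pcd : (@lebesgue_measure R).-integrable `[c, d] (EFin \o horner p).
  apply: continuous_compact_integrable; first exact: segment_compact.
  by apply: continuous_subspaceT; exact: continuous_horner.
by apply: integrableS pcd => //; apply: subset_itvr; rewrite bnd_simp.
Qed.

Definition poly_integral (R : realType) (c d : R) (p : {poly R}) : R :=
  \int[@lebesgue_measure R]_(t in `]c, d]) p.[t].

Lemma poly_integral_EFin (R : realType) (c d : R) (p : {poly R}) :
  (\int[@lebesgue_measure R]_(t in `]c, d]) (p.[t])%:E = (poly_integral c d p)%:E)%E.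
Proof.
by rewrite fineK //; apply: integrable_fin_num => //; exact: integrable_horner.
Qed.

Lemma poly_integral_sqr_ge0 (R : realType) (c d : R) (p : {poly R}) :
  0 <= poly_integral c d (p ^+ 2).
Proof. by apply: Rintegral_ge0 => t _; rewrite horner_exp sqr_ge0. Qed.

Lemma poly_integral_is_scalar (R : realType) (c d : R) :
  scalar (poly_integral c d : {poly R} -> R).
Proof.
move=> u p q; rewrite /poly_integral;
  under eq_Rintegral do rewrite hornerD hornerZ.
rewrite RintegralD ?RintegralZl //; first exact: integrable_horner.
- by apply: (eq_integrable _ _ _ _ (integrable_horner (u *: p) c d)) => // t _ /=; rewrite hornerZ.
- exact: integrable_horner.
Qed.

HB.instance Definition _ (R : realType) (c d : R) :=
  GRing.isLinear.Build R {poly R} R _ (poly_integral c d) (poly_integral_is_scalar c d).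

(** Measurability is proved along with the value because additivity of the
    integral requires it. *)
Lemma integral_pieces (R : realType) (g : R -> R) (y : nat -> R) (p
    : nat -> {poly R}) (q : nat) :
  (forall s, (s < q)%N -> y s <= y s.+1) ->
  (forall t, 0 <= g t) ->
  (forall s t, (s < q)%N -> y s < t <= y s.+1 -> g t = (p s).[t]) ->
  measurable_fun `]y 0%N, y q] g /\
  (\int[@lebesgue_measure R]_(t in `]y 0%N, y q]) (g t)%:E =
    (\sum_(s < q) poly_integral (y s) (y s.+1) (p s))%:E)%E.
Proof.
move=> ymono g0; elim: q ymono => [|q IH] ymono gp.
  rewrite set_itv_ge ?bnd_simp ?ltxx // integral_set0 big_ord0; split=> //.
  exact: measurable_fun_set0.
have [|s t sq|mq iq] := IH; [by move=> s sq; exact/ymono/leqW|exact/gp/leqW|].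
have y0q : y 0%N <= y q.
  elim: q ymono {IH gp mq iq} => // q IH ymono.
  by apply: le_trans (ymono q _) => //; apply: IH => s sq; exact/ymono/leqW.
have gq t : `]y q, y q.+1]%classic t -> g t = (p q).[t].
  by rewrite /= in_itv /= => tq; exact: gp.
have yE : `]y 0%N, y q.+1]%classic = `]y 0%N, y q] `|` `]y q, y q.+1].
  by rewrite -itv_bndbnd_setU ?bnd_simp ?ymono.
have mq' : measurable_fun `]y q, y q.+1] g.
  apply: (eq_measurable_fun (horner (p q))) => [t|];
    first by rewrite inE => /gq.
  exact: measurable_poly.
have mg : measurable_fun (`]y 0%N, y q] `|` `]y q, y q.+1]) g.
  by apply/measurable_funU.
rewrite yE; split=> //; rewrite ge0_integral_setU //=.
- rewrite iq big_ord_recr /= EFinD; congr (_ + _)%E;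
  rewrite -poly_integral_EFin.
  by apply: eq_integral => t; rewrite inE => /gq ->.
- exact/measurable_EFinP.
- by move=> t _; rewrite lee_fin.
- by apply/disj_setPLR => t /=; rewrite !in_itv /= => /andP[_ tq];
  rewrite ltNge tq.
Qed.

(** * Pieces of a discrete spline *)

(** The polynomial part of a falling factorial basis function.  Truncated
    subtraction and [minn] make one formula cover both ranges of [j]. *)
Definition falling_poly (R : realType) (k : nat) (x : seq R)
    (j : nat) : {poly R} :=
  ((minn j k)`!%:R)^-1 *: \prod_(j - k <= l < j) ('X - (x`_l)%:P).

Lemma falling_factorialE (R : realType) (k : nat) (x : seq R) (j : nat) (t
    : R) :
  Defs.falling_factorial k x j t =
  (falling_poly k x j).[t] * ((j <= k)%N || (x`_j.-1 < t))%:R.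
Proof.
rewrite /Defs.falling_factorial /falling_poly hornerZ horner_prod.
under [in RHS]eq_bigr do rewrite hornerXsubC.
case: leqP => [jk|kj]; last by [].
by rewrite mulr1 (eqP (jk : _ - _ == 0)%N).
Qed.

Lemma size_falling_poly (R : realType) (k : nat) (x : seq R) (j : nat) :
  (size (falling_poly k x j) <= k.+1)%N.
Proof.
apply: leq_trans (size_scale_leq _ _) _.
rewrite -(big_map (fun l => x`_l) xpredT (fun c => 'X - c%:P)) size_prod_XsubC.
by rewrite size_map size_iota ltnS leq_subLR addnC -leq_subLR.
Qed.

Lemma falling_poly_root (R : realType) (k : nat) (x : seq R) (j l : nat) :
  (j - k <= l < j)%N -> (falling_poly k x j).[x`_l] = 0.
Proof.
move=> ljk; rewrite hornerZ horner_prod (big_rem l) ?mem_index_iota //=.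
by rewrite hornerXsubC subrr mul0r mulr0.
Qed.

Lemma tuple_leq_nth (R : realType) (n : nat) (x : n.-tuple R) (i j : nat) :
  sorted <%R x -> (i <= j < n)%N -> x`_i <= x`_j.
Proof.
move=> xs /andP[ij jn].
by rewrite (lt_sorted_leq_nth 0 xs) ?inE ?size_tuple // (leq_ltn_trans ij).
Qed.

Lemma tuple_ltn_nth (R : realType) (n : nat) (x : n.-tuple R) (i j : nat) :
  sorted <%R x -> (i < j < n)%N -> x`_i < x`_j.
Proof.
move=> xs /andP[ij jn].
by rewrite (lt_sorted_ltn_nth 0 xs) ?inE ?size_tuple // (ltn_trans ij).
Qed.

(** The polynomial equal to the spline between [x`_j.-1] and [x`_j],
    for [k <= j]: it omits the truncated terms that are still zero there. *)
Definition spline_piece (R : realType) (k n : nat) (x : seq R) (c : 'I_n -> R)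
    (j : nat) : {poly R} :=
  \sum_(i < n | (i <= j)%N) c i *: falling_poly k x i.

Lemma size_spline_piece (R : realType) (k n : nat) (x : seq R) (c : 'I_n -> R)
    (j : nat) :
  (size (spline_piece k x c j) <= k.+1)%N.
Proof.
apply: leq_trans (size_sum _ _ _) _; apply/bigmax_leqP => i _.
exact: leq_trans (size_scale_leq _ _) (size_falling_poly _ _ _).
Qed.

(** The first piece ([j = k]) is unbounded on the left and the last one
    ([j = n.-1]) on the right, hence the guarded inequalities. *)
Lemma discrete_spline_piece (R : realType) (k n : nat) (x : n.-tuple R)
    (c : 'I_n -> R) (j : nat) (t : R) :
  sorted <%R x -> (k <= j < n)%N -> ((k < j)%N -> x`_j.-1 < t) ->
  ((j.+1 < n)%N -> t <= x`_j) ->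
  \sum_(i < n) c i * Defs.falling_factorial k x i t = (spline_piece k x c j).[t].
Proof.
move=> xs /andP[kj jn] lt_t t_le; rewrite horner_sum [RHS]big_mkcond;
  apply: eq_bigr => i _.
rewrite falling_factorialE [in RHS]hornerZ; have [ij|ji] := leqP i j.
  have [ik|ki] := leqP i k; first by rewrite /= mulr1.
  have kj' : (k < j)%N by exact: leq_trans ij.
  have xij : x`_i.-1 <= x`_j.-1 by apply: tuple_leq_nth => //; lia.
  by rewrite /= (le_lt_trans xij (lt_t kj')) mulr1.
have ni := ltn_ord i.
have xji : x`_j <= x`_i.-1 by apply: tuple_leq_nth => //; lia.
have tx : t <= x`_i.-1 by apply: le_trans xji; apply: t_le; lia.
by rewrite leqNgt (leq_ltn_trans kj ji) ltNge tx !mulr0.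
Qed.

(** On the piece ending at [x`_j] the interpolation reaches back beyond the
    piece itself: a term whose truncation is active in the piece but not yet at
    [x`_l] has a polynomial part that vanishes at [x`_l]. *)
Lemma discrete_spline_interp (R : realType) (k n : nat) (x : n.-tuple R)
    (c : 'I_n -> R) (j l : nat) :
  sorted <%R x -> (k <= j < n)%N -> (j - k <= l <= j)%N ->
  \sum_(i < n) c i * Defs.falling_factorial k x i x`_l = (spline_piece k x c j).[x`_l].
Proof.
move=> xs /andP[kj jn] /andP[jkl lj].
rewrite horner_sum [RHS]big_mkcond; apply: eq_bigr => i _.
have ni := ltn_ord i.
rewrite falling_factorialE [in RHS]hornerZ; have [ij|ji] := leqP i j.
  have [ik|ki] := leqP i k; first by rewrite /= mulr1.
  have [il|li] := ltnP i.-1 l; last by rewrite falling_poly_root ?mul0r //; lia.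
  have xil : x`_i.-1 < x`_l by apply: tuple_ltn_nth => //; lia.
  by rewrite xil mulr1.
have xli : x`_l <= x`_i.-1 by apply: tuple_leq_nth => //; lia.
by rewrite leqNgt (leq_ltn_trans kj ji) ltNge xli !mulr0.
Qed.

(** The ends of the pieces from [a] to [b]: only the [n - k - 1] design points
    from [x`_k] to [x`_n.-2] are knots. *)
Definition spline_break (R : realType) (k n : nat) (x : seq R) (a b : R)
    (s : nat) : R :=
  if s is s'.+1 then (if (s < n - k)%N then x`_(k + s') else b) else a.

Lemma spline_break_le (R : realType) (k n : nat) (x : n.-tuple R) (a b : R)
    (s : nat) :
  sorted <%R x -> a <= x`_0 -> x`_n.-1 <= b -> (s < n - k)%N ->
  spline_break k n x a b s <= spline_break k n x a b s.+1.
Proof.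
move=> xs ax xb sn.
have xle i j : (i <= j < n)%N -> x`_i <= x`_j.
  exact: tuple_leq_nth.
rewrite /spline_break; case: s sn => [|s] sn.
  case: ltnP => n1; first by apply: le_trans ax _; apply: xle; lia.
  by apply: le_trans ax (le_trans _ xb); apply: xle; lia.
rewrite sn; case: ltnP => n1; first by apply: xle; lia.
by apply: le_trans xb; apply: xle; lia.
Qed.

(** * The banded quadratic form *)

(** The matrix of the quadratic form integrating the square of the function
    equal to [\sum_i u i 0 *: g s i] on the piece from [y s] to [y s.+1]. *)
Definition gram_mx (R : realType) (q p : nat) (y : nat -> R)
    (g : 'I_q -> 'I_p -> {poly R}) : 'M[R]_p :=
  \matrix_(i, j) \sum_(s < q) poly_integral (y s) (y s.+1) (g s i * g s j).

Lemma gram_mx_form (R : realType) (q p : nat) (y : nat -> R)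
    (g : 'I_q -> 'I_p -> {poly R}) (u : 'cV[R]_p) :
  (u^T *m gram_mx y g *m u) 0 0 =
  \sum_(s < q) poly_integral (y s) (y s.+1) ((\sum_i u i 0 *: g s i) ^+ 2).
Proof.
transitivity (\sum_j \sum_i \sum_(s < q)
    u i 0 * u j 0 * poly_integral (y s) (y s.+1) (g s i * g s j)).
  rewrite mxE; apply: eq_bigr => j _; rewrite mxE mulr_suml;
    apply: eq_bigr => i _.
  by rewrite !mxE mulr_sumr mulr_suml; apply: eq_bigr => s _; rewrite mulrAC.
under eq_bigr do rewrite exchange_big /=.
rewrite exchange_big /=; apply: eq_bigr => s _.
rewrite expr2 mulr_sumr linear_sum; apply: eq_bigr => j _.
rewrite mulr_suml linear_sum; apply: eq_bigr => i _ /=.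
by rewrite -[in RHS]scalerAl -[in RHS]scalerAr !linearZ /= mulrA.
Qed.

Lemma big_window (V : nmodType) (F : nat -> V) (s m N : nat) :
  (s + m <= N)%N ->
  \sum_(i < N) (if (s <= i < s + m)%N then F (i - s)%N else 0) = \sum_(i < m) F i.
Proof.
move=> smN;
  rewrite -(big_mkord xpredT (fun i => if (s <= i < s + m)%N then F (i - s)%N else 0)).
rewrite (@big_cat_nat _ _ _ s) //=; last by rewrite (leq_trans _ smN) ?leq_addr.
rewrite big_nat_cond big1 ?add0r => [|i];
  last by rewrite andbT /= => /ltn_geF ->.
rewrite (@big_cat_nat _ _ _ (s + m)) ?leq_addr //=.
rewrite [X in _ + X]big_nat_cond [X in _ + X]big1 ?addr0 => [|i]; last first.
  by case/andP=> /andP[/leq_gtF smi _] _; rewrite smi andbF.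
rewrite -{1}[s]add0n big_addn addKn big_mkord; apply: eq_bigr => i _.
by rewrite addnK leq_addl addnC ltn_add2l ltn_ord.
Qed.

Theorem theorem5 (R : realType) (k m n : nat) (a b : R) (x : n.-tuple R)
    (hkm : k = (2 * m - 1)%N) (hk : (1 <= k)%N) (hn : (k + 1 <= n)%N)
    (hx : sorted <%R x) (hax : a <= x`_0) (hxb : x`_n.-1 <= b) :
  exists V : 'M[R]_(n - m),
    [/\ V^T = V,
        psd_mx V,
        forall i j : 'I_(n - m), (m <= `|i - j|)%N -> V i j = 0 &
        forall f : R -> R, discrete_spline k x f ->
          (\int[lebesgue_measure]_(t in `[a, b]) (lderive1n m f t ^+ 2)%:E =
           (l2norm (sqrt_mx V *m (discrete_derive_mx m x *m sample f x))
              ^+ 2)%:E)%E].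
Proof.
have /choice[G GE] (s : 'I_(n - k)) : exists G : nat -> {poly R},
    forall p : {poly R}, (size p <= m + m)%N ->
    p^`(m) = \sum_(i < m)
      (m`!%:R * divdiff (horner p) (fun l => x`_(s + (i + l))) m) *: G i.
  apply: (derivn_divdiff (z := fun l => x`_(s + l))) => i j /andP[ij jm].
  have sn := ltn_ord s.
  by rewrite lt_eqF //; apply: tuple_ltn_nth => //; lia.
pose y := spline_break k n x a b.
(* On piece [s], only the entries [s, ..., s + m - 1] of [D_n^m f(x)] matter. *)
pose g (s : 'I_(n - k)) (i : 'I_(n - m)) :=
  if (s <= i < s + m)%N then G s (i - s)%N else 0.
pose V := gram_mx y g.
have symV : V^T = V.
  by apply/matrixP => i j; rewrite !mxE; apply: eq_bigr => s _; rewrite mulrC.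
have psdV : psd_mx V.
  by move=> u; rewrite gram_mx_form sumr_ge0 // => s _;
    exact: poly_integral_sqr_ge0.
exists V; split=> // [i j ij|f [c fE]].
  rewrite mxE big1 // => s _; rewrite /g.
  case: ifP => si; last by rewrite mul0r raddf0.
  case: ifP => sj; last by rewrite mulr0 raddf0.
  by exfalso; move: ij si sj; lia.
rewrite l2norm_sqrt_mx // gram_mx_form.
have fpiece s t : (s < n - k)%N -> y s < t <= y s.+1 ->
    f t = (spline_piece k x c (k + s)).[t].
  move=> sn /andP[yt ty]; rewrite fE; apply: discrete_spline_piece => //.
  - lia.
  - by case: s sn yt {ty} => [|s] sn; rewrite /y /= ?sn ?addn0 ?ltnn ?addnS.
  - move=> kn; move: ty; rewrite /y /= ifT //; lia.
have piece_derivn (s : 'I_(n - k)) : (spline_piece k x c (k + s))^`(m) =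
    \sum_i (discrete_derive_mx m x *m sample f x) i 0 *: g s i.
  have sn := ltn_ord s.
  rewrite (GE s); last by apply: leq_trans (size_spline_piece _ _ _ _) _; lia.
  rewrite -(@big_window _ (fun i =>
    (m`!%:R * divdiff (horner (spline_piece k x c (k + s)))
      (fun l => x`_(s + (i + l))) m) *: G s i) s m (n - m)); last lia.
  apply: eq_bigr => i _; rewrite /g; case: ifP => [/andP[si ism]|];
    last by rewrite scaler0.
  rewrite discrete_derive_mxE // mxE; congr (_ * _ *: _).
  rewrite (_ : (fun l => x`_(s + (i - s + l))) = (fun l => x`_(i + l)));
    last first.
    by apply/funext => l; rewrite addnA subnKC.
  apply: eq_divdiff => l lm; rewrite fE -discrete_spline_interp //; lia.
have [|t|s t sn tI|mf If] := @integral_pieces R (fun t => lderive1n m f t ^+ 2) y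
  (fun s => (spline_piece k x c (k + s))^`(m) ^+ 2) (n - k).
- by move=> s sn; exact: spline_break_le.
- exact: sqr_ge0.
- rewrite horner_exp; congr (_ ^+ 2).
  exact: (lderive1n_horner m (fun u => @fpiece s u sn) tI).
have nk : (0 < n - k)%N by lia.
have yb : y (n - k)%N = b.
  by rewrite /y /spline_break; case: (n - k)%N nk => // d _; rewrite ltnn.
rewrite yb in mf If.
(* The left end point [a] belongs to no piece, but has measure zero. *)
rewrite -integral_itv_obnd_cbnd; last exact/measurable_EFinP.
by rewrite If; congr EFin; apply: eq_bigr => s _; rewrite piece_derivn.
Qed.
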